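(* Two reduced linear trellises $T$ and $T'$ of the same length $n$ are linearly isomorphic if and only if for every span $\mathfrak{s}$ both $$\dim\mathbb{S}_{\mathfrak{s}}(T)=\dim\mathbb{S}_{\mathfrak{s}}(T')\quad\text{and}\quad C_{\mathfrak{s}}(T)=C_{\mathfrak{s}}(T')$$ hold. In particular, two one-to-one reduced linear trellises $T,T'$ of the same length are linearly isomorphic if and only if $C_{\mathfrak{s}}(T)=C_{\mathfrak{s}}(T')$ for all spans $\mathfrak{s}$.
   Context: Let $\mathbb{F}$ be a finite field and $n\ge1$; indices are taken in $\mathbb{Z}_n$. A trellis $T$ of length $n$ over $\mathbb{F}$ consists of pairwise disjoint finite vertex sets $V_i(T)$, $i\in\mathbb{Z}_n$, and edge sets $E_i(T)\subseteq V_i(T)\times\mathbb{F}\times V_{i+1}(T)$; $(v,\alpha,w)\in E_i(T)$ is an edge from $v$ to $w$ with label $\alpha$. Trellises are trim (each vertex has an outgoing and an incoming edge). $T$ is linear if each $V_i(T)$ is an $\mathbb{F}$-vector space and each $E_i(T)$ a subspace of $V_i(T)\times\mathbb{F}\times V_{i+1}(T)$. A cycle is a closed path of length $n$ starting in $V_0(T)$, identified with $(\mathbf{v},\boldsymbol{\alpha})\in\prod_iV_i(T)\times\mathbb{F}^n$; $\mathbb{S}(T)$ is the space of cycles, $L(\mathbf{v},\boldsymbol{\alpha})=\boldsymbol{\alpha}$. $T$ is reduced if every edge lies on a cycle, and one-to-one if $L$ is injective on $\mathbb{S}(T)$. A linear isomorphism $f:T\to T'$ is a family of linear bijections $f_i:V_i(T)\to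 V_i(T')$ with $(v,\alpha,w)\in E_i(T)\iff(f_i(v),\alpha,f_{i+1}(w))\in E_i(T')$. Spans: for $a\in\mathbb{Z}_n$, $0\le l\le n-1$, $[a,a+l]=\{a,\dots,a+l\}\subseteq\mathbb{Z}_n$, $(a,a+l]=[a,a+l]\setminus\{a\}$; the pair $(a,l)$ is a span; also degenerate spans $\emptyset$ and $\mathbb{Z}_n$. A nondegenerate $(a,l)$ is a span of a cycle $(\mathbf{v},\boldsymbol{\alpha})$ if $\{i:v_i\ne0\}\subseteq(a,a+l]$ and $\{i:\alpha_i\ne0\}\subseteq[a,a+l]$; $\emptyset$ is a span only of the zero cycle and $\mathbb{Z}_n$ of every cycle. $\mathbb{S}_{\mathfrak{s}}(T)$ is the subspace of cycles having span $\mathfrak{s}$ and $C_{\mathfrak{s}}(T):=L(\mathbb{S}_{\mathfrak{s}}(T))$. *)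

(* Defs.v *)
From HB Require Import structures.
From mathcomp Require Import all_boot all_order all_algebra all_field.
Set Implicit Arguments. Unset Strict Implicit. Unset Printing Implicit Defensive.
Import GRing.Theory.
Local Open Scope ring_scope.

(* Indices Z_n are represented by 'I_n (n >= 1); i+1 is ordS i. *)

Section Trellis.
Variables (F : finFieldType) (n : nat) (vT : vectType F).

Definition edgeT := ((vT * F^o) * vT)%type.
(* Cycle space: vertex families  x  label words. *)
Definition cycT := ({ffun 'I_n -> vT} * {ffun 'I_n -> F^o})%type.

Record trellis := Trellis {
  tV : 'I_n -> {vspace vT};
  tE : 'I_n -> {vspace edgeT}
}.

Variable T : trellis.

Definition trellis_wf : Prop :=
  forall i : 'I_n,
    (forall e : edgeT, e \in tE T i -> e.1.1 \in tV T i /\ e.2 \in tV T (ordS i))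
    /\ (forall v, v \in tV T i -> exists a w, ((v, a), w) \in tE T i)
    /\ (forall w, w \in tV T (ordS i) -> exists v a, ((v, a), w) \in tE T i).

Definition cyc_edge (i : 'I_n) (c : cycT) : edgeT := ((c.1 i, c.2 i), c.1 (ordS i)).

Definition cycles : {vspace cycT} :=
  (\bigcap_(i < n) (linfun (cyc_edge i) @^-1: tE T i))%VS.

Definition labL (c : cycT) : {ffun 'I_n -> F^o} := c.2.

Definition reduced : Prop :=
  forall (i : 'I_n) (e : edgeT), e \in tE T i ->
    exists2 c, c \in cycles & cyc_edge i c = e.

Definition one_to_one : Prop :=
  forall c1 c2, c1 \in cycles -> c2 \in cycles -> labL c1 = labL c2 -> c1 = c2.

End Trellis.

Arguments trellis : clear implicits.
Arguments cycT : clear implicits.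
Arguments edgeT : clear implicits.

Inductive trspan (n : nat) :=
| SpanEmpty
| SpanFull
| SpanNd of 'I_n & 'I_n.  (* (a, l) with 0 <= l <= n-1 *)

(* i \in [a, a+l]  (indices mod n) *)
Definition in_cspan n (a l i : 'I_n) : bool := (((i + n - a) %% n) <= l)%N.
(* i \in (a, a+l] = [a, a+l] \ {a} *)
Definition in_hspan n (a l i : 'I_n) : bool :=
  (0 < (i + n - a) %% n)%N && (((i + n - a) %% n) <= l)%N.

Section Spans.
Variables (F : finFieldType) (n : nat) (vT : vectType F).

Definition outside (a l : 'I_n) (c : cycT F n vT) : cycT F n vT :=
  ([ffun i => if in_hspan a l i then 0 else c.1 i],
   [ffun i => if in_cspan a l i then 0 else c.2 i]).

Definition cycles_span (T : trellis F n vT) (s : trspan n) : {vspace cycT F n vT} :=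
  match s with
  | SpanEmpty => 0%VS
  | SpanFull => cycles T
  | SpanNd a l => (cycles T :&: lker (linfun (outside a l)))%VS
  end.

Definition code_span (T : trellis F n vT) (s : trspan n) : {vspace {ffun 'I_n -> F^o}} :=
  (linfun (@labL F n vT) @: cycles_span T s)%VS.

End Spans.

Definition lin_iso (F : finFieldType) (n : nat) (vT vT' : vectType F)
  (T : trellis F n vT) (T' : trellis F n vT') : Prop :=
  exists f : 'I_n -> 'Hom(vT, vT'),
    forall i : 'I_n,
      [/\ (f i @: tV T i)%VS = tV T' i,
          {in tV T i &, injective (f i)} &
          forall v w (a : F^o), v \in tV T i -> w \in tV T (ordS i) ->
            (((v, a), w) \in tE T i) = (((f i v, a), f (ordS i) w) \in tE T' i)].

(* Main.v *)
Require Import Defs.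
From HB Require Import structures.
From mathcomp Require Import all_boot all_algebra zify.
Set Implicit Arguments.
Unset Strict Implicit.
Unset Printing Implicit Defensive.
Import GRing.Theory.
Local Open Scope ring_scope.

(* A reduced trellis is recovered, up to linear isomorphism, from its space of
   cycles, the labels of the cycles and the subspaces of cycles through the zero
   vertex at time i: V_i is the quotient by this subspace, and E_i is an image
   of the space of cycles.  The cycles through the zero vertex at time i are
   those with span (i, n-1), so a linear isomorphism of trellises amounts to a
   label preserving isomorphism g of the cycle spaces that respects all spans.

   Given equal dimensions and codes, g is built by adding the spans one at a
   time in order of increasing length.  When (a, l) with l > 0 is reached, every
   cycle of a span added so far passes through the zero vertex at some time in
   (a, a+l] and can be cut there; cutting all the summands of a cycle with span
   (a, l) writes it as a sum of cycles with spans (a, l-1) and (a+1, l-1).  So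
   the new space meets the sum of the old ones in a sum of spaces on which g is
   already defined, and g extends to it by counting dimensions. *)

Section LinearMapsOnSubspaces.
Variables (K : fieldType) (V W : vectType K).
Implicit Types (f g : 'Hom(V, W)) (U X : {vspace V}) (Y : {vspace W}).

Lemma lfun_in_injP f U :
  {in U &, injective f} <-> {in U, forall u, f u = 0 -> u = 0}.
Proof.
split=> [f_inj u uU fu0 | f0 u v uU vU fuv].
  by apply: f_inj; rewrite ?mem0v ?fu0 ?linear0.
apply/eqP; rewrite -subr_eq0; apply/eqP; apply: f0; first exact: memvB.
by rewrite linearB /= fuv subrr.
Qed.

Lemma capv_lker0P f U :
  reflect {in U &, injective f} ((U :&: lker f)%VS == 0%VS).
Proof.
apply: (iffP eqP) => [U0 | /lfun_in_injP f0].
  apply/lfun_in_injP=> u uU fu0; apply/eqP.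
  by rewrite -memv0 -U0 memv_cap uU memv_ker fu0 eqxx.
apply/eqP; rewrite -subv0; apply/subvP=> u /memv_capP[uU].
by rewrite memv_ker memv0 => /eqP/(f0 _ uU)->.
Qed.

Lemma limg_inj_dim f U : {in U &, injective f} -> \dim (f @: U) = \dim U.
Proof. by move/capv_lker0P/eqP/limg_dim_eq. Qed.

Lemma limg_dim_inj f U : \dim (f @: U) = \dim U -> {in U &, injective f}.
Proof.
move=> dim_fU; apply/capv_lker0P.
by rewrite -dimv_eq0 -(eqn_add2r (\dim (f @: U))) limg_ker_dim add0n dim_fU.
Qed.

Lemma eq_in_addv f g U X :
  {in U, f =1 g} -> {in X, f =1 g} -> {in (U + X)%VS, f =1 g}.
Proof.
by move=> fgU fgX _ /memv_addP[u uU [x xX ->]]; rewrite !linearD /= fgU ?fgX.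
Qed.

Lemma addv_diffK U X : (U <= X)%VS -> (U + (X :\: U))%VS = X.
Proof. by move=> UX; rewrite addvC addv_diff; apply/addv_idPl. Qed.

Lemma lfun_glue f g U X :
    {in (U :&: X)%VS, f =1 g} ->
  exists2 h : 'Hom(V, W), {in U, h =1 f} & {in X, h =1 g}.
Proof.
move=> fg; exists ((f \o addv_pi1 U X)%VF + (g \o addv_pi2 U X)%VF) => u uS.
  have u_sum : addv_pi1 U X u + addv_pi2 U X u = u.
    by apply: addv_pi1_pi2; apply: subvP uS; apply: addvSl.
  have pi2U : addv_pi2 U X u \in U.
    by rewrite -[_ u](addKr (addv_pi1 U X u)) u_sum memvD ?memvN ?memv_pi1.
  rewrite add_lfunE !comp_lfunE -fg ?memv_cap ?pi2U ?memv_pi2 //.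
  by rewrite -linearD u_sum.
have pi2u := addv_pi2_id U uS.
have pi1u : addv_pi1 U X u = 0.
  apply: (addIr u); rewrite add0r -{2}pi2u addv_pi1_pi2 //.
  by apply: subvP uS; apply: addvSr.
by rewrite add_lfunE !comp_lfunE pi1u pi2u linear0 add0r.
Qed.

Lemma lfun_glue_diff f g U X :
  exists2 h : 'Hom(V, W), {in U, h =1 f} & {in (X :\: U)%VS, h =1 g}.
Proof.
apply: lfun_glue => u; rewrite capvC capv_diff memv0 => /eqP->.
by rewrite !linear0.
Qed.

End LinearMapsOnSubspaces.

Section IsomorphismsOfSubspaces.
Variables (K : fieldType) (V V' : vectType K).
Implicit Types (U X : {vspace V}) (W Y : {vspace V'}) (f g : 'Hom(V, V')).

Definition vspace_iso U W f : Prop :=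
  {in U &, injective f} /\ (f @: U = W)%VS.

Lemma vspace_iso_dim U W f : vspace_iso U W f -> \dim U = \dim W.
Proof. by case=> f_inj <-; rewrite limg_inj_dim. Qed.

Lemma vspace_iso_of_inj U W f :
    {in U &, injective f} -> (f @: U <= W)%VS -> \dim U = \dim W ->
  vspace_iso U W f.
Proof.
move=> f_inj fUW dimU; split=> //.
by apply/eqP; rewrite eqEdim fUW limg_inj_dim ?dimU /=.
Qed.

Lemma eq_vspace_iso U W f g :
  {in U, g =1 f} -> vspace_iso U W f -> vspace_iso U W g.
Proof.
move=> gf [f_inj fU]; split; last by rewrite (eq_in_limg gf).
by move=> u v uU vU; rewrite !gf //; apply: f_inj.
Qed.

Lemma sub_vspace_iso U X W f :
  (X <= U)%VS -> vspace_iso U W f -> vspace_iso X (f @: X) f.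
Proof. by move=> /subvP XU [f_inj _]; split=> //; apply: sub_in2 f_inj. Qed.

Lemma vspace_iso_addv U W X Y f :
    vspace_iso U W f -> vspace_iso X Y f ->
    (f @: (U :&: X) = W :&: Y)%VS ->
  vspace_iso (U + X) (W + Y) f.
Proof.
move=> [f_injU fU] [f_injX fX] fUX; split; last by rewrite limgD fU fX.
apply/lfun_in_injP=> _ /memv_addP[u uU [x xX ->]] fux0.
have xU : x \in U.
  have fx_eq : f x = - f u.
    by apply/eqP; rewrite -addr_eq0 addrC -linearD /= fux0.
  have : f x \in (W :&: Y)%VS.
    by rewrite memv_cap -fX memv_img // fx_eq memvN -fU memv_img.
  rewrite -fUX => /memv_imgP[y /memv_capP[yU yX] /f_injX].
  by move=> ->.
by move/lfun_in_injP: f_injU; apply; rewrite ?memvD.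
Qed.

Lemma exists_vspace_iso U W :
  \dim U = \dim W -> exists f, vspace_iso U W f.
Proof.
move=> dimU; have [f fP] := linear_of_free (vbasis U) (vbasis W).
have fU : (linfun f @: U = W)%VS.
  rewrite -(span_basis (vbasisP U)) limg_span -(span_basis (vbasisP W)).
  rewrite -fP ?(basis_free (vbasisP U)) ?size_tuple //.
  by congr <<_>>%VS; apply: eq_map => u; rewrite lfunE.
by exists (linfun f); split; rewrite ?fU //; apply: limg_dim_inj; rewrite fU.
Qed.

Lemma vspace_iso_extend U W X Y f :
    (U <= X)%VS -> (W <= Y)%VS -> \dim X = \dim Y -> vspace_iso U W f ->
  exists2 g : 'Hom(V, V'), {in U, g =1 f} & vspace_iso X Y g.
Proof.
move=> UX WY dimX f_iso.
have dim_diff : \dim (X :\: U) = \dim (Y :\: W).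
  move: (dimv_cap_compl X U) (dimv_cap_compl Y W) (vspace_iso_dim f_iso).
  by rewrite (capv_idPr UX) (capv_idPr WY); lia.
have [k k_iso] := exists_vspace_iso dim_diff.
have [g gU gdiff] := lfun_glue_diff f k U X.
exists g => //; rewrite -(addv_diffK UX) -(addv_diffK WY).
apply: vspace_iso_addv.
- exact: eq_vspace_iso f_iso.
- exact: eq_vspace_iso k_iso.
- by rewrite ![(_ :&: (_ :\: _))%VS]capvC !capv_diff limg0.
Qed.

End IsomorphismsOfSubspaces.

Section LabelPreservingIsomorphisms.
Variables (K : fieldType) (V V' Z : vectType K).
Variables (L : 'Hom(V, Z)) (L' : 'Hom(V', Z)).
Implicit Types (U X : {vspace V}) (W Y : {vspace V'}) (f g : 'Hom(V, V')).

Definition label_iso U W f : Prop :=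
  vspace_iso U W f /\ {in U, (L' \o f)%VF =1 L}.

Lemma label_iso_labels U W f : label_iso U W f -> (L @: U = L' @: W)%VS.
Proof. by case=> [[_ <-] Lf]; rewrite -(eq_in_limg Lf) limg_comp. Qed.

Lemma eq_label_iso U W f g :
  {in U, g =1 f} -> label_iso U W f -> label_iso U W g.
Proof.
move=> gf [f_iso Lf]; split; first exact: eq_vspace_iso f_iso.
by move=> u uU; rewrite comp_lfunE gf // -comp_lfunE Lf.
Qed.

Lemma sub_label_iso U X W f :
  (X <= U)%VS -> label_iso U W f -> label_iso X (f @: X) f.
Proof.
move=> XU [f_iso Lf]; split; first exact: sub_vspace_iso f_iso.
by apply: sub_in1 Lf; apply/subvP.
Qed.

Lemma label_iso_addv U W X Y f :
    label_iso U W f -> label_iso X Y f ->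
    (f @: (U :&: X) = W :&: Y)%VS ->
  label_iso (U + X) (W + Y) f.
Proof.
move=> [isoU LU] [isoX LX] fUX.
by split; [exact: vspace_iso_addv | exact: eq_in_addv].
Qed.

Lemma label_iso_cap_lker U X W Y f :
    label_iso U W f -> (f @: (U :&: X) = W :&: Y)%VS ->
  (f @: (U :&: (X :&: lker L)) = W :&: (Y :&: lker L'))%VS.
Proof.
move=> [_ Lf] fUX; rewrite !capvA -fUX; apply/vspaceP=> y; rewrite memv_cap.
have kerE u : u \in U -> (f u \in lker L') = (u \in lker L).
  by move=> uU; rewrite !memv_ker -Lf // comp_lfunE.
apply/memv_imgP/andP=> [[u /memv_capP[uUX uL] ->]|[/memv_imgP[u uUX ->]]].
  by have /memv_capP[uU _] := uUX; rewrite memv_img // kerE.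
have /memv_capP[uU _] := uUX.
by rewrite kerE // => uL; exists u; rewrite // memv_cap uUX.
Qed.

Lemma label_iso_extend_lker U W X Y f :
    (U <= X)%VS -> (W <= Y)%VS -> \dim X = \dim Y ->
    (L @: X = L' @: Y)%VS -> label_iso U W f ->
  exists2 g : 'Hom(V, V'), {in U, g =1 f} &
    label_iso (U + X :&: lker L) (W + Y :&: lker L') g.
Proof.
move=> UX WY dimX labX f_iso; have [[f_inj fU] Lf] := f_iso.
pose N := (X :&: lker L)%VS; pose N' := (Y :&: lker L')%VS.
have dimN : \dim N = \dim N'.
  by apply/eqP; rewrite -(eqn_add2r (\dim (L @: X))) {2}labX !limg_ker_dim dimX.
have fUN : (f @: (U :&: N) = W :&: N')%VS.
  by apply: label_iso_cap_lker f_iso _; rewrite (capv_idPl UX) (capv_idPl WY).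
have isoUN : vspace_iso (U :&: N) (W :&: N') f.
  by rewrite -fUN; apply: sub_vspace_iso f_iso.1; apply: capvSl.
have [k kf isoN] := vspace_iso_extend (capvSr U N) (capvSr W N') dimN isoUN.
have [|g gf gk] := @lfun_glue _ _ _ f k U N; first by move=> u /kf.
exists g => //; apply: label_iso_addv; first exact: eq_label_iso f_iso.
  apply: (eq_label_iso gk); split=> // u uN; have [_ uL] := memv_capP uN.
  have := memv_img k uN; rewrite isoN.2 => /memv_capP[_].
  by rewrite comp_lfunE; move: uL; rewrite !memv_ker => /eqP-> /eqP->.
by rewrite -fUN; apply: eq_in_limg => u /memv_capP[/gf].
Qed.

(* The labels are injective on a complement of [U] in [X], so there any linear
   choice of preimages under [L'] in [Y] will do. *)
Lemma label_iso_extend_over_lker U W X Y f :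
    (X :&: lker L <= U)%VS -> (U <= X)%VS -> (W <= Y)%VS ->
    \dim X = \dim Y -> (L @: X = L' @: Y)%VS -> label_iso U W f ->
  exists2 g : 'Hom(V, V'), {in U, g =1 f} & label_iso X Y g.
Proof.
move=> NU UX WY dimX labX [[f_inj fU] Lf].
pose s := (projv Y \o ((L' \o projv Y)^-1 \o L))%VF.
have sY u : s u \in Y by rewrite comp_lfunE memv_proj.
have Ls : {in X, (L' \o s)%VF =1 L}.
  move=> u uX; rewrite !comp_lfunE -[L' (projv _ _)]comp_lfunE limg_lfunVK //.
  by rewrite limg_comp limg_proj -labX memv_img.
have [g gU gdiff] := lfun_glue_diff f s U X.
have Lg : {in X, (L' \o g)%VF =1 L}.
  rewrite -(addv_diffK UX); apply: eq_in_addv => u uS; rewrite comp_lfunE.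
    by rewrite gU // -comp_lfunE Lf.
  by rewrite gdiff // -comp_lfunE Ls // (subvP (diffvSl X U)).
exists g => //; split=> //; apply: vspace_iso_of_inj => //.
  apply/lfun_in_injP=> u uX gu0.
  have uU : u \in U.
    apply: (subvP NU).
    by rewrite memv_cap uX memv_ker -Lg // comp_lfunE gu0 linear0 eqxx.
  by move/lfun_in_injP: f_inj; apply; rewrite -?gU.
rewrite -(addv_diffK UX) limgD subv_add (eq_in_limg gU) fU WY /=.
by apply/subvP=> _ /memv_imgP[u u_diff ->]; rewrite gdiff.
Qed.

Lemma label_iso_extend U W X Y f :
    (U <= X)%VS -> (W <= Y)%VS -> \dim X = \dim Y ->
    (L @: X = L' @: Y)%VS -> label_iso U W f ->
  exists2 g : 'Hom(V, V'), {in U, g =1 f} & label_iso X Y g.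
Proof.
move=> UX WY dimX labX f_iso.
have [h hf h_iso] := label_iso_extend_lker UX WY dimX labX f_iso.
have [|||g gh g_iso] := label_iso_extend_over_lker _ _ _ dimX labX h_iso.
- exact: addvSr.
- by rewrite subv_add UX capvSl.
- by rewrite subv_add WY capvSl.
exists g => // u uU; rewrite gh ?hf //.
by apply: subvP uU; apply: addvSl.
Qed.

Lemma label_iso_extend_addv U W X Y f :
    label_iso U W f -> (f @: (U :&: X) = W :&: Y)%VS ->
    \dim X = \dim Y -> (L @: X = L' @: Y)%VS ->
  exists g : 'Hom(V, V'),
    [/\ {in U, g =1 f}, label_iso X Y g & label_iso (U + X) (W + Y) g].
Proof.
move=> f_iso fUX dimX labX.
have isoUX : label_iso (U :&: X) (W :&: Y) f.
  by rewrite -fUX; apply: sub_label_iso f_iso; apply: capvSl.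
have [k kf k_iso] := label_iso_extend (capvSr U X) (capvSr W Y) dimX labX isoUX.
have [|g gf gk] := @lfun_glue _ _ _ f k U X; first by move=> u /kf.
have gX : label_iso X Y g by apply: eq_label_iso k_iso.
exists g; split=> //.
apply: label_iso_addv => //; first exact: eq_label_iso f_iso.
by rewrite -fUX; apply: eq_in_limg => u /memv_capP[/gf].
Qed.

End LabelPreservingIsomorphisms.

Section GradedFamilies.
Variables (K : fieldType) (I : finType) (len : I -> nat) (lower : I -> {set I}).

(* [A] is the set of members treated before [i] when the family is processed in
   an order of nondecreasing [len]. *)
Definition graded_family (V : vectType K) (X : I -> {vspace V}) : Prop :=
  forall (A : {set I}) i,
    i \notin A -> {in A, forall j, len j <= len i}%N ->
    (forall j, len j < len i -> j \in A)%N ->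
  ((\sum_(j in A) X j) :&: X i = \sum_(j in lower i) X j)%VS.

Variables (V V' Z : vectType K) (L : 'Hom(V, Z)) (L' : 'Hom(V', Z)).
Variables (X : I -> {vspace V}) (Y : I -> {vspace V'}).
Hypothesis lower_lt : forall i j, j \in lower i -> (len j < len i)%N.
Hypotheses (grX : graded_family X) (grY : graded_family Y).
Hypothesis dimXY : forall i, \dim (X i) = \dim (Y i).
Hypothesis labXY : forall i, (L @: X i = L' @: Y i)%VS.

Lemma graded_family_label_iso (A : {set I}) :
    (forall i j, i \in A -> len j < len i -> j \in A)%N ->
  exists2 f, {in A, forall i, label_iso L L' (X i) (Y i) f} &
    label_iso L L' (\sum_(i in A) X i) (\sum_(i in A) Y i) f.
Proof.
have [m] := ubnP #|A|; elim: m A => // m IHm A ltAm A_closed.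
have [-> | [i0 i0A]] := set_0Vmem A.
  exists 0 => [i|]; rewrite ?inE // !big_set0; split.
    split; last by rewrite limg0.
    by move=> u v /[!memv0] /eqP-> /eqP->.
  by move=> u /[!memv0] /eqP->; rewrite !linear0.
have [i iA i_max] : exists2 i, i \in A & {in A, forall j, len j <= len i}%N.
  by case: (arg_maxnP len i0A) => i; exists i.
have [||f fA f_sum] := IHm (A :\ i).
- by move: ltAm; rewrite (cardsD1 i A) iA.
- move=> j k /setD1P[_ jA] ltkj; rewrite !inE (A_closed _ _ jA ltkj) andbT.
  by apply: contraTneq ltkj => ->; rewrite -leqNgt i_max.
have lt_A' j : (len j < len i)%N -> j \in A :\ i.
  move=> ltji; rewrite !inE (A_closed _ _ iA ltji) andbT.
  by apply: contraTneq ltji => ->; rewrite ltnn.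
have le_A' : {in A :\ i, forall j, len j <= len i}%N.
  by move=> j /setD1P[_ /i_max].
have i_notin : i \notin A :\ i by rewrite setD11.
have fX : (f @: ((\sum_(j in A :\ i) X j) :&: X i)
           = (\sum_(j in A :\ i) Y j) :&: Y i)%VS.
  rewrite grX // grY // limg_sum; apply: eq_bigr => j /lower_lt/lt_A' jA'.
  by have [[_ ->] _] := fA j jA'.
have [g [gf gi g_sum]] := label_iso_extend_addv f_sum fX (dimXY i) (labXY i).
exists g; last by rewrite !(big_setD1 i iA) /= ![(_ i + _)%VS]addvC.
move=> j jA; have [-> // | ji] := eqVneq j i.
have jA' : j \in A :\ i by rewrite !inE ji.
apply: eq_label_iso (fA j jA') => u uj; apply: gf.
by apply: subvP uj; apply: (sumv_sup j).
Qed.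

End GradedFamilies.

Section Factorization.
Variables (K : fieldType) (V W1 W2 : vectType K).

Lemma lfun_factor (r : 'Hom(V, W1)) (s : 'Hom(V, W2)) (U : {vspace V}) :
    {in U, forall u, r u = 0 -> s u = 0} ->
  exists f : 'Hom(W1, W2), {in U, forall u, f (r u) = s u}.
Proof.
move=> rs0; pose rU := (r \o projv U)%VF.
exists (s \o (projv U \o rU^-1))%VF => u uU; rewrite !comp_lfunE.
set v := projv U _; have vU : v \in U by apply: memv_proj.
have rv : r v = r u.
  rewrite -[r v]comp_lfunE limg_lfunVK // limg_comp limg_proj.
  exact: memv_img.
apply/eqP; rewrite -subr_eq0 -linearB; apply/eqP/rs0; first exact: memvB.
by rewrite linearB /= rv subrr.
Qed.

End Factorization.

Section CyclicOffsets.
Variable n : nat.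
Implicit Types a b i j l m : 'I_n.

Definition offset a i : nat := (i + n - a) %% n.

Lemma offsetE a i : offset a i = (if a <= i then i - a else i + n - a)%N.
Proof.
have [ltan ltin] := (ltn_ord a, ltn_ord i); rewrite /offset; case: leqP => ai.
  by rewrite addnC -addnBA // modnDl modn_small //; lia.
by rewrite modn_small //; lia.
Qed.

Lemma offset_lt a i : (offset a i < n)%N.
Proof. by rewrite ltn_mod (leq_ltn_trans _ (ltn_ord a)). Qed.

Lemma offset_inj a : injective (offset a).
Proof.
move=> i j; have [ltan ltin ltjn] := And3 (ltn_ord a) (ltn_ord i) (ltn_ord j).
rewrite !offsetE => ij; apply: val_inj => /=; move: ij.
by do 2!case: leqP => ?; lia.
Qed.

Lemma offset_id a : offset a a = 0%N.
Proof. by rewrite offsetE leqnn subnn. Qed.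

Lemma offset_eq0 a i : (offset a i == 0)%N = (i == a).
Proof. by rewrite -(inj_eq (@offset_inj a)) offset_id. Qed.

Lemma offset_surj a l : exists i, offset a i = l.
Proof.
have [ltan ltln] := (ltn_ord a, ltn_ord l).
have lt_n : ((if a + l < n then a + l else a + l - n) < n)%N.
  by case: (ltnP (a + l)%N); lia.
exists (Ordinal lt_n); rewrite offsetE /=.
by case: (ltnP (a + l)%N) => ?; case: leqP => ?; lia.
Qed.

Lemma offsetS a i :
  offset a (ordS i) = (if (offset a i).+1 == n then 0 else (offset a i).+1)%N.
Proof.
have [ltan ltin] := (ltn_ord a, ltn_ord i).
have ordSE : ordS i = (if i.+1 == n then 0 else i.+1)%N :> nat.
  by rewrite /=; case: eqP => [->|ne]; rewrite ?modnn ?modn_small //; lia.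
rewrite !offsetE ordSE.
by case: (_.+1 =P n) => ?; do ![case: leqP => ? | case: eqP => ?]; lia.
Qed.

Lemma offset_rebase a b i :
  offset b i = (if offset a b <= offset a i then offset a i - offset a b
                else offset a i + n - offset a b)%N.
Proof.
have [ltan ltin ltbn] := And3 (ltn_ord a) (ltn_ord i) (ltn_ord b).
rewrite !offsetE; case: (leqP a b) => ?; case: (leqP a i) => ?.
all: by do !case: leqP => ?; lia.
Qed.

Lemma in_hspanE a l i : in_hspan a l i = (0 < offset a i <= l)%N.
Proof. by []. Qed.

Lemma in_cspanE a l i : in_cspan a l i = (offset a i <= l)%N.
Proof. by []. Qed.

Lemma in_hspan_rebase a b m i : (offset a b + m < n)%N ->
  in_hspan b m i = (offset a b < offset a i <= offset a b + m)%N.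
Proof.
move=> abm; rewrite in_hspanE (offset_rebase a b).
by have := offset_lt a i; case: (leqP (offset a b)); lia.
Qed.

Lemma in_cspan_rebase a b m i : (offset a b + m < n)%N ->
  in_cspan b m i = (offset a b <= offset a i <= offset a b + m)%N.
Proof.
move=> abm; rewrite in_cspanE (offset_rebase a b).
by have := offset_lt a i; case: (leqP (offset a b)); lia.
Qed.

Lemma in_hspan_sub a l b m i :
  (offset a b + m <= l)%N -> in_hspan b m i -> in_hspan a l i.
Proof.
move=> abl; rewrite (@in_hspan_rebase a) ?(leq_ltn_trans abl) //.
by rewrite in_hspanE; lia.
Qed.

Lemma in_cspan_sub a l b m i :
  (offset a b + m <= l)%N -> in_cspan b m i -> in_cspan a l i.
Proof.
move=> abl; rewrite (@in_cspan_rebase a) ?(leq_ltn_trans abl) //.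
by rewrite in_cspanE; lia.
Qed.

Lemma exists_in_hspan_notin a l b m :
    (0 < l)%N -> (m <= l)%N -> (b, m) != (a, l) ->
  exists2 i, in_hspan a l i & ~~ in_hspan b m i.
Proof.
move=> l_gt0 le_ml bm_neq; have [bl | bl] := boolP (in_hspan a l b).
  by exists b; rewrite // in_hspanE offset_id.
have [i ai] := offset_surj a l; have ltab := offset_lt a b.
exists i; rewrite in_hspanE ?ai ?l_gt0 ?leqnn // (offset_rebase a b) ai.
have [ba | ab] := eqVneq (offset a b) 0%N; last first.
  move: bl; rewrite in_hspanE lt0n ab -ltnNge => lt_l.
  by rewrite (leqNgt (offset a b)) lt_l /=; lia.
have ml : m != l.
  move/eqP: ba; rewrite offset_eq0 => /eqP ba.
  by apply: contraNneq bm_neq => ->; rewrite ba.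
by rewrite ba; move: ml; rewrite -val_eqE /=; lia.
Qed.

Definition span_len (t : 'I_n * 'I_n) : nat := t.2.

Definition proper_subspans (t : 'I_n * 'I_n) : {set 'I_n * 'I_n} :=
  [set u : 'I_n * 'I_n | (span_len u < span_len t)
                         && (offset t.1 u.1 + span_len u <= span_len t)]%N.

Lemma proper_subspans_len (t u : 'I_n * 'I_n) :
  u \in proper_subspans t -> (span_len u < span_len t)%N.
Proof. by rewrite inE => /andP[]. Qed.

End CyclicOffsets.

Section Cycles.
Variables (F : finFieldType) (n : nat) (vT : vectType F).
Implicit Types (T : trellis F n vT) (c d : cycT F n vT) (a b l m i j : 'I_n).

Definition cyc_vertex i c : vT := c.1 i.

Fact cyc_vertex_is_linear i : linear (cyc_vertex i).
Proof. by move=> k c d; rewrite /cyc_vertex /= !ffunE. Qed.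
HB.instance Definition _ i :=
  GRing.isLinear.Build F (cycT F n vT) vT _ (cyc_vertex i)
    (cyc_vertex_is_linear i).

Fact cyc_edge_is_linear i : linear (@cyc_edge F n vT i).
Proof. by move=> k c d; rewrite /cyc_edge /= !ffunE. Qed.
HB.instance Definition _ i :=
  GRing.isLinear.Build F (cycT F n vT) (edgeT F vT) _ (@cyc_edge F n vT i)
    (cyc_edge_is_linear i).

Fact labL_is_linear : linear (@labL F n vT).
Proof. by []. Qed.
HB.instance Definition _ :=
  GRing.isLinear.Build F (cycT F n vT) {ffun 'I_n -> F^o} _ (@labL F n vT)
    labL_is_linear.

Fact outside_is_linear a l : linear (@outside F n vT a l).
Proof.
move=> k c d; congr pair; apply/ffunP=> i; rewrite !ffunE /=.
  by case: ifP; rewrite ?scaler0 ?addr0.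
by case: ifP; rewrite ?scaler0 ?addr0.
Qed.
HB.instance Definition _ a l :=
  GRing.isLinear.Build F (cycT F n vT) (cycT F n vT) _ (@outside F n vT a l)
    (outside_is_linear a l).

Lemma eq_cyc c d : c.1 =1 d.1 -> c.2 =1 d.2 -> c = d.
Proof. by case: c d => [v x] [w y] /= /ffunP-> /ffunP->. Qed.

Lemma sum_cyc_vertex (I : finType) (P : pred I) (y : I -> cycT F n vT) i :
  (\sum_(k | P k) y k).1 i = \sum_(k | P k) (y k).1 i.
Proof. exact: (linear_sum (cyc_vertex i)). Qed.

Lemma sum_cyc_label (I : finType) (P : pred I) (y : I -> cycT F n vT) i :
  (\sum_(k | P k) y k).2 i = \sum_(k | P k) (y k).2 i.
Proof. by rewrite -[LHS]/(labL _ i) linear_sum sum_ffunE. Qed.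

Lemma cyclesP T c :
  reflect (forall i, cyc_edge i c \in tE T i) (c \in cycles T).
Proof.
rewrite memvE; apply: (iffP subv_bigcapP) => cE i.
  by have := cE i isT; rewrite -memvE -memv_preim lfunE.
by move=> _; rewrite -memvE -memv_preim lfunE; apply: cE.
Qed.

Lemma cycles_spanP T a l c :
  reflect [/\ c \in cycles T,
              forall i, ~~ in_hspan a l i -> c.1 i = 0 &
              forall i, ~~ in_cspan a l i -> c.2 i = 0]
          (c \in cycles_span T (SpanNd a l)).
Proof.
apply: (iffP memv_capP) => [[cT]|[cT vtx0 lab0]].
  rewrite memv_ker lfunE => /eqP[/ffunP vtx0 /ffunP lab0].
  split=> // i /negPf ai.
    by have := vtx0 i; rewrite !ffunE ai.
  by have := lab0 i; rewrite !ffunE ai.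
split=> //; rewrite memv_ker lfunE; apply/eqP/eq_cyc => i; rewrite !ffunE.
  by case: ifPn => // /vtx0.
by case: ifPn => // /lab0.
Qed.

Lemma cycles_span_sub T s : (cycles_span T s <= cycles T)%VS.
Proof. by case: s => [||a l] /=; rewrite ?sub0v ?capvSl. Qed.

Lemma cycles_spanS T a l b m : (offset a b + m <= l)%N ->
  (cycles_span T (SpanNd b m) <= cycles_span T (SpanNd a l))%VS.
Proof.
move=> abl; apply/subvP=> c /cycles_spanP[cT vtx0 lab0]; apply/cycles_spanP.
split=> // i ai; [apply: vtx0 | apply: lab0]; apply: contra ai.
  exact: in_hspan_sub.
exact: in_cspan_sub.
Qed.

Definition cycles_through0 T i : {vspace cycT F n vT} :=
  (cycles T :&: lker (linfun (cyc_vertex i)))%VS.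

Lemma cycles_through0P T i c :
  reflect (c \in cycles T /\ c.1 i = 0) (c \in cycles_through0 T i).
Proof. by apply: (iffP memv_capP); rewrite memv_ker lfunE => -[cT /eqP]. Qed.

Lemma cycles_span_through0 T a l i :
  ~~ in_hspan a l i -> (cycles_span T (SpanNd a l) <= cycles_through0 T i)%VS.
Proof.
move=> ai; apply/subvP=> c /cycles_spanP[cT vtx0 _].
by apply/cycles_through0P; split=> //; apply: vtx0.
Qed.

Lemma mem_cycles_span_max T i l c : l.+1 = n -> c \in cycles T ->
  (c \in cycles_span T (SpanNd i l)) = (c.1 i == 0).
Proof.
move=> ln cT; have le_l j : (offset i j <= l)%N by rewrite -ltnS ln offset_lt.
apply/cycles_spanP/eqP=> [[_ vtx0 _] | ci0].
  by apply: vtx0; rewrite in_hspanE offset_id.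
split=> // j; rewrite ?in_hspanE ?in_cspanE le_l // andbT.
by rewrite lt0n offset_eq0 negbK => /eqP->.
Qed.

Definition cyc_trunc a i c : cycT F n vT :=
  ([ffun j => if (offset a j < offset a i)%N then c.1 j else 0],
   [ffun j => if (offset a j < offset a i)%N then c.2 j else 0]).

Lemma cyc_trunc_vertex a i j c :
  c.1 i = 0 -> (offset a j <= offset a i)%N -> (cyc_trunc a i c).1 j = c.1 j.
Proof.
move=> ci0; rewrite ffunE leq_eqVlt => /orP[/eqP/offset_inj-> | ->] //.
by rewrite ltnn ci0.
Qed.

Lemma cyc_trunc_edge T a i j c :
    c \in cycles_through0 T i -> ((offset a j).+1 < n)%N ->
  cyc_edge j (cyc_trunc a i c) \in tE T j.
Proof.
case/cycles_through0P=> cT ci0 lt_jn.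
have jS : offset a (ordS j) = (offset a j).+1 by rewrite offsetS ltn_eqF.
have [ji | ij] := ltnP (offset a j) (offset a i).
  have le_ji := ltnW ji; rewrite /cyc_edge !cyc_trunc_vertex ?jS // ffunE ji.
  by move/cyclesP: cT; apply.
by rewrite /cyc_edge /= !ffunE jS ltnNge ij ltnNge leqW //= mem0v.
Qed.

Section SplittingCycles.
Variables (T : trellis F n vT) (a l : 'I_n) (x : 'I_n -> cycT F n vT).
Hypothesis x_through0 : forall i, in_hspan a l i -> x i \in cycles_through0 T i.
Let c := \sum_(i | in_hspan a l i) x i.

Definition cut_prefix : cycT F n vT :=
  \sum_(i | in_hspan a l i) cyc_trunc a i (x i).

Lemma cut_prefix_vertex_eq j : (offset a j <= 1)%N -> cut_prefix.1 j = c.1 j.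
Proof.
move=> j_le1; rewrite !sum_cyc_vertex; apply: eq_bigr => i il.
have /cycles_through0P[_ xi0] := x_through0 il.
by apply: cyc_trunc_vertex; move: il; rewrite // in_hspanE; lia.
Qed.

Lemma cut_prefix_label_eq : cut_prefix.2 a = c.2 a.
Proof.
rewrite !sum_cyc_label; apply: eq_bigr => i.
rewrite in_hspanE => /andP[i_gt0 _].
by rewrite ffunE offset_id i_gt0.
Qed.

Lemma cut_prefix_vertex0 j : (l <= offset a j)%N -> cut_prefix.1 j = 0.
Proof.
move=> lj; rewrite sum_cyc_vertex big1 // => i.
rewrite in_hspanE => /andP[_ il].
by rewrite ffunE ltnNge (leq_trans il lj).
Qed.

Lemma cut_prefix_label0 j : (l <= offset a j)%N -> cut_prefix.2 j = 0.
Proof.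
move=> lj; rewrite sum_cyc_label big1 // => i.
rewrite in_hspanE => /andP[_ il].
by rewrite ffunE ltnNge (leq_trans il lj).
Qed.

(* The truncated summands need not be cycles: all of them return to the zero
   vertex, but only their sum is known to start there. *)
Lemma cut_prefix_cycles : c.1 a = 0 -> cut_prefix \in cycles T.
Proof.
move=> ca0; apply/cyclesP=> j; have := offset_lt a j.
rewrite leq_eqVlt => /predU1P[jn | lt_jn].
  have lj : (l <= offset a j)%N by rewrite -ltnS jn.
  have -> : cyc_edge j cut_prefix = 0.
    have jS : ordS j = a by apply/eqP; rewrite -offset_eq0 offsetS jn eqxx.
    rewrite /cyc_edge jS cut_prefix_vertex0 // cut_prefix_label0 //.
    by rewrite cut_prefix_vertex_eq ?ca0 // offset_id.
  exact: mem0v.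
rewrite linear_sum memv_suml // => i il.
exact: cyc_trunc_edge (x_through0 il) lt_jn.
Qed.

Lemma cut_prefix_span m : (m.+1 = l)%N ->
  c \in cycles_span T (SpanNd a l) -> cut_prefix \in cycles_span T (SpanNd a m).
Proof.
move=> ml /cycles_spanP[_ vtx0 _].
have ca0 : c.1 a = 0 by apply: vtx0; rewrite in_hspanE offset_id.
apply/cycles_spanP; split=> [|j|j].
- exact: cut_prefix_cycles.
- have [/eqP | j_gt0] := posnP (offset a j).
    by rewrite offset_eq0 => /eqP-> _; rewrite cut_prefix_vertex_eq ?offset_id.
  by rewrite in_hspanE j_gt0 -ltnNge -ltnS ml; apply: cut_prefix_vertex0.
- by rewrite in_cspanE -ltnNge -ltnS ml; apply: cut_prefix_label0.
Qed.

Lemma cut_suffix_span m : (m.+1 = l)%N ->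
    c \in cycles_span T (SpanNd a l) ->
  c - cut_prefix \in cycles_span T (SpanNd (ordS a) m).
Proof.
move=> ml c_span; have [cT vtx0 lab0] := cycles_spanP _ _ _ _ c_span.
have /(subvP (cycles_span_sub _ _)) dT := cut_prefix_span ml c_span.
have lt_ln := ltn_ord l.
have offset_aS : offset a (ordS a) = 1%N.
  by rewrite offsetS offset_id ifN //; lia.
apply/cycles_spanP; split; first exact: memvB.
- move=> j; rewrite (@in_hspan_rebase _ a) offset_aS ?add1n ?ml // => jP.
  suff : c.1 j = cut_prefix.1 j by rewrite /= !ffunE => ->; rewrite subrr.
  have [/cut_prefix_vertex_eq-> // | j_gt1] := leqP (offset a j) 1.
  rewrite j_gt1 -ltnNge in jP; rewrite cut_prefix_vertex0 1?ltnW //.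
  by apply: vtx0; rewrite in_hspanE negb_and -!ltnNge jP orbT.
- move=> j; rewrite (@in_cspan_rebase _ a) offset_aS ?add1n ?ml // => jP.
  suff : c.2 j = cut_prefix.2 j by rewrite /= !ffunE => ->; rewrite subrr.
  have [/eqP | j_gt0] := posnP (offset a j).
    by rewrite offset_eq0 => /eqP->; rewrite cut_prefix_label_eq.
  rewrite j_gt0 -ltnNge in jP; rewrite cut_prefix_label0 1?ltnW //.
  by apply: lab0; rewrite in_cspanE -ltnNge.
Qed.

End SplittingCycles.

Lemma cycles_span_split T a l m : (m.+1 = l)%N ->
  (cycles_span T (SpanNd a l) :&: \sum_(i | in_hspan a l i) cycles_through0 T i
   <= cycles_span T (SpanNd a m) + cycles_span T (SpanNd (ordS a) m))%VS.
Proof.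
move=> ml; apply/subvP=> c /memv_capP[c_span /memv_sumP[x x_through0 c_sum]].
rewrite c_sum in c_span; rewrite c_sum.
apply/memv_addP; exists (cut_prefix a l x); first exact: cut_prefix_span c_span.
exists (c - cut_prefix a l x); last by rewrite c_sum addrC subrK.
by rewrite c_sum; apply: cut_suffix_span.
Qed.

Lemma cycles_span_len0_cap T (A : {set 'I_n * 'I_n}) a l :
    (a, l) \notin A -> l = 0%N :> nat -> {in A, forall t, span_len t = 0%N} ->
  ((\sum_(t in A) cycles_span T (SpanNd t.1 t.2)) :&: cycles_span T (SpanNd a l)
   = 0)%VS.
Proof.
move=> alA l0 len0; apply/eqP; rewrite -subv0; apply/subvP=> c.
case/memv_capP=> /memv_sumP[x xP c_sum] /cycles_spanP[_ vtx0 lab0].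
rewrite memv0; apply/eqP/eq_cyc => i; rewrite ffunE.
  by apply: vtx0; rewrite in_hspanE l0; lia.
have [-> | ia] := eqVneq i a; last first.
  by apply: lab0; rewrite in_cspanE l0 leqn0 offset_eq0.
rewrite c_sum sum_cyc_label big1 // => -[b m] bmA.
have /cycles_spanP[_ _] := xP _ bmA; apply.
have m0 : m = 0%N :> nat := len0 _ bmA.
rewrite in_cspanE /= m0 leqn0 offset_eq0.
apply: contraNneq alA => ->.
by have -> : l = m by apply: val_inj; rewrite /= l0 m0.
Qed.

Lemma cycles_span_cap_sub T (A : {set 'I_n * 'I_n}) a l :
    (a, l) \notin A -> (0 < l)%N -> {in A, forall t, span_len t <= l}%N ->
  (\sum_(t in A) cycles_span T (SpanNd t.1 t.2)
   <= \sum_(i | in_hspan a l i) cycles_through0 T i)%VS.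
Proof.
move=> alA l_gt0 le_A; apply/subv_sumP=> -[b m] bmA.
have bm_neq : (b, m) != (a, l) by apply: contraNneq alA => <-.
have [i ai bi] := exists_in_hspan_notin l_gt0 (le_A _ bmA) bm_neq.
by apply: (sumv_sup i) => //; apply: cycles_span_through0.
Qed.

Lemma cycles_span_graded T :
  graded_family (@span_len n) (@proper_subspans n)
    (fun t => cycles_span T (SpanNd t.1 t.2)).
Proof.
move=> A [a l] alA le_A lt_A; apply/eqP; rewrite eqEsubv andbC subv_cap.
apply/andP; split; last first.
  have [l0 | l_gt0] := posnP l.
    rewrite cycles_span_len0_cap ?sub0v // => t /le_A.
    by rewrite [span_len (a, l)]l0 leqn0 => /eqP.
  have lt_ml : (l.-1 < n)%N by have := ltn_ord l; lia.
  have ml : (Ordinal lt_ml).+1 = l by rewrite /= prednK.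
  rewrite capvC; apply: subv_trans (capvS (subvv _) _) _.
    exact: cycles_span_cap_sub alA l_gt0 le_A.
  apply: subv_trans (cycles_span_split T a ml) _; rewrite subv_add.
  have lt_ln := ltn_ord l.
  apply/andP; split.
    apply: (sumv_sup (a, Ordinal lt_ml)) => //.
    by rewrite inE /span_len /= offset_id; lia.
  apply: (sumv_sup (ordS a, Ordinal lt_ml)) => //.
  by rewrite inE /span_len /= offsetS offset_id; case: eqP; lia.
apply/andP; split; apply/subv_sumP=> t; rewrite inE => /andP[lt_tl sub_tl].
  by apply: (sumv_sup t) => //; apply: lt_A.
exact: cycles_spanS.
Qed.

End Cycles.

Section CycleIsomorphisms.
Variables (F : finFieldType) (n : nat) (vT vT' : vectType F).
Variables (T : trellis F n vT) (T' : trellis F n vT').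

Definition cycle_iso (g : 'Hom(cycT F n vT, cycT F n vT')) : Prop :=
  forall s : trspan n,
    label_iso (linfun (@labL F n vT)) (linfun (@labL F n vT'))
      (cycles_span T s) (cycles_span T' s) g.

Definition same_span_data : Prop :=
  forall s : trspan n,
    \dim (cycles_span T s) = \dim (cycles_span T' s) /\
    code_span T s = code_span T' s.

Lemma cycle_iso_same_span_data g : cycle_iso g -> same_span_data.
Proof.
move=> g_iso s; split; last exact: label_iso_labels (g_iso s).
by have [/vspace_iso_dim] := g_iso s.
Qed.

Lemma same_span_data_cycle_iso : same_span_data -> exists g, cycle_iso g.
Proof.
move=> same_spans.
have [|f fS f_sum] := graded_family_label_iso (@proper_subspans_len n)
    (cycles_span_graded T) (cycles_span_graded T')
    (fun t => (same_spans (SpanNd t.1 t.2)).1)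
    (fun t => (same_spans (SpanNd t.1 t.2)).2) (A := setT).
  by move=> *; rewrite inE.
have sum_sub (vU : vectType F) (R : trellis F n vU) :
    (\sum_(t in [set: 'I_n * 'I_n]) cycles_span R (SpanNd t.1 t.2)
     <= cycles R)%VS.
  by apply/subv_sumP=> t _; apply: cycles_span_sub.
have [dim_full lab_full] := same_spans (SpanFull n).
have [g gf g_full] :=
  label_iso_extend (sum_sub _ T) (sum_sub _ T') dim_full lab_full f_sum.
exists g => -[||a l] //.
  by rewrite /= -(limg0 g); apply: sub_label_iso g_full; apply: sub0v.
apply: eq_label_iso (fS (a, l) (in_setT _)) => c cS; apply: gf.
by apply: subvP cS; apply: (sumv_sup (a, l)); rewrite ?inE.
Qed.

Lemma cycle_iso_mem g s c : cycle_iso g ->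
  c \in cycles T -> (g c \in cycles_span T' s) = (c \in cycles_span T s).
Proof.
move=> g_iso cT; have [[g_inj _] _] := g_iso (SpanFull n).
have [[_ <-] _] := g_iso s; apply/idP/idP=> [|cS]; last exact: memv_img.
case/memv_imgP=> d dS /g_inj -> //.
exact: subvP (cycles_span_sub T s) d dS.
Qed.

Lemma cycle_iso_vertex0 g i c : cycle_iso g ->
  c \in cycles T -> ((g c).1 i == 0) = (c.1 i == 0).
Proof.
move=> g_iso cT; have n_gt0 := leq_ltn_trans (leq0n i) (ltn_ord i).
have lt_ln : (n.-1 < n)%N by rewrite prednK.
have gcT : g c \in cycles T' by rewrite (cycle_iso_mem (SpanFull n) g_iso cT).
have ln : (Ordinal lt_ln).+1 = n by rewrite /= prednK.
rewrite -(mem_cycles_span_max i ln gcT) -(mem_cycles_span_max i ln cT).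
exact: cycle_iso_mem.
Qed.

End CycleIsomorphisms.

Section ReducedTrellises.
Variables (F : finFieldType) (n : nat) (vT : vectType F) (T : trellis F n vT).
Hypothesis wfT : trellis_wf T.

Lemma cycle_vertex_mem c i : c \in cycles T -> c.1 i \in tV T i.
Proof. by move/cyclesP/(_ i); have [memE _] := wfT i; case/memE. Qed.

Lemma reduced_vertexE i : reduced T ->
  tV T i = (linfun (@cyc_vertex F n vT i) @: cycles T)%VS.
Proof.
move=> redT; apply/vspaceP=> v; apply/idP/memv_imgP=> [v_mem | [c cT ->]].
  have [_ [out _]] := wfT i; have [a [w /redT[c cT [<- _ _]]]] := out v v_mem.
  by exists c; rewrite ?lfunE.
by rewrite lfunE; apply: cycle_vertex_mem.
Qed.

Lemma reduced_edgeE i : reduced T ->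
  tE T i = (linfun (@cyc_edge F n vT i) @: cycles T)%VS.
Proof.
move=> redT; apply/vspaceP=> e.
apply/idP/memv_imgP=> [/redT[c cT <-] | [c cT ->]].
  by exists c; rewrite ?lfunE.
by rewrite lfunE; move/cyclesP: cT; apply.
Qed.

End ReducedTrellises.

Section CycleIsoToLinIso.
Variables (F : finFieldType) (n : nat) (vT vT' : vectType F).
Variables (T : trellis F n vT) (T' : trellis F n vT').
Hypotheses (wfT : trellis_wf T) (wfT' : trellis_wf T').
Hypotheses (redT : reduced T) (redT' : reduced T').
Variable g : 'Hom(cycT F n vT, cycT F n vT').
Hypothesis g_iso : cycle_iso T T' g.

Lemma cycle_iso_vertex_map i :
  exists f : 'Hom(vT, vT'),
    {in cycles T, forall c : cycT F n vT, f (c.1 i) = (g c).1 i}.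
Proof.
have [c cT | f fP] := @lfun_factor _ _ _ _ (linfun (@cyc_vertex F n vT i))
  (linfun (@cyc_vertex F n vT' i) \o g)%VF (cycles T).
  rewrite comp_lfunE !lfunE => /eqP.
  by rewrite -(cycle_iso_vertex0 _ g_iso) // => /eqP.
by exists f => c cT; have := fP c cT; rewrite comp_lfunE !lfunE.
Qed.

Lemma cycle_iso_lin_iso : lin_iso T T'.
Proof.
have [f fP] := fin_all_exists cycle_iso_vertex_map.
have [[_ /= gT] gL] := g_iso (SpanFull n).
have g_edge i c : c \in cycles T ->
    cyc_edge i (g c) = (f i (c.1 i), c.2 i, f (ordS i) (c.1 (ordS i))).
  move=> cT; rewrite /cyc_edge !fP //; congr (_, _, _).
  by have := gL c cT; rewrite comp_lfunE !lfunE => /ffunP.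
have f_inj i : {in tV T i &, injective (f i)}.
  apply/lfun_in_injP=> v.
  rewrite (reduced_vertexE wfT) // => /memv_imgP[c cT ->].
  rewrite lfunE /cyc_vertex fP // => /eqP.
  by rewrite (cycle_iso_vertex0 _ g_iso) // => /eqP.
exists f => i; split=> // [|v w a vV wV].
  rewrite (reduced_vertexE wfT) // (reduced_vertexE wfT') // -gT -!limg_comp.
  by apply: eq_in_limg => c cT; rewrite !comp_lfunE !lfunE /cyc_vertex fP.
rewrite (reduced_edgeE _ redT) (reduced_edgeE _ redT').
apply/memv_imgP/memv_imgP=> -[c cT]; rewrite lfunE /=.
  move=> [-> -> ->]; exists (g c); first by rewrite -gT memv_img.
  by rewrite lfunE /= g_edge.
move: cT; rewrite -gT => /memv_imgP[d dT ->]; rewrite g_edge // => -[fv -> fw].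
have dV j : d.1 j \in tV T j by apply: cycle_vertex_mem.
exists d; rewrite // lfunE /= /cyc_edge.
by rewrite (f_inj i _ _ vV (dV i) fv) (f_inj _ _ _ wV (dV _) fw).
Qed.

End CycleIsoToLinIso.

Section LinIsoToCycleIso.
Variables (F : finFieldType) (n : nat) (vT vT' : vectType F).
Variables (T : trellis F n vT) (T' : trellis F n vT').
Hypotheses (wfT : trellis_wf T) (wfT' : trellis_wf T').
Implicit Types c : cycT F n vT.
Variable f : 'I_n -> 'Hom(vT, vT').
Hypothesis f_vertices : forall i, vspace_iso (tV T i) (tV T' i) (f i).
Hypothesis f_edges : forall i v w (a : F^o),
  v \in tV T i -> w \in tV T (ordS i) ->
  ((v, a, w) \in tE T i) = ((f i v, a, f (ordS i) w) \in tE T' i).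

Definition cyc_map (c : cycT F n vT) : cycT F n vT' :=
  ([ffun i => f i (c.1 i)], c.2).

Fact cyc_map_is_linear : linear cyc_map.
Proof.
by move=> k c d; congr pair; apply/ffunP=> i; rewrite !ffunE /= linearP.
Qed.
HB.instance Definition _ :=
  GRing.isLinear.Build F (cycT F n vT) (cycT F n vT') _ cyc_map
    cyc_map_is_linear.

Lemma cyc_map_inj : {in cycles T &, injective cyc_map}.
Proof.
move=> c d cT dT [/ffunP eq_vtx eq_lab].
apply: eq_cyc => i; last by rewrite eq_lab.
have [f_inj _] := f_vertices i; apply: f_inj; rewrite ?cycle_vertex_mem //.
by have := eq_vtx i; rewrite !ffunE.
Qed.

Lemma cyc_map_cycles c : (forall i, c.1 i \in tV T i) ->
  (cyc_map c \in cycles T') = (c \in cycles T).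
Proof.
move=> cV; apply/cyclesP/cyclesP=> cE i.
  by have := cE i; rewrite /cyc_edge !ffunE -f_edges.
by rewrite /cyc_edge !ffunE -f_edges //; apply: cE.
Qed.

Lemma limg_cyc_map : (linfun cyc_map @: cycles T = cycles T')%VS.
Proof.
apply/vspaceP=> d; apply/memv_imgP/idP=> [[c cT ->] | dT'].
  by rewrite lfunE cyc_map_cycles // => i; apply: cycle_vertex_mem.
have lift i : exists v, v \in tV T i /\ f i v = d.1 i.
  have [_ fV] := f_vertices i.
  have := cycle_vertex_mem wfT' i dT'; rewrite -fV => /memv_imgP[v vV ->].
  by exists v.
have [v vP] := fin_all_exists lift.
pose c : cycT F n vT := ([ffun i => v i], d.2).
have cd : cyc_map c = d.
  by apply: eq_cyc => // i; rewrite !ffunE; case: (vP i).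
exists c; rewrite ?lfunE // -cyc_map_cycles ?cd // => i.
by rewrite ffunE; case: (vP i).
Qed.

Lemma cyc_map_span s c :
  c \in cycles T -> (cyc_map c \in cycles_span T' s) = (c \in cycles_span T s).
Proof.
move=> cT; have fcT : cyc_map c \in cycles T'.
  by rewrite cyc_map_cycles // => i; apply: cycle_vertex_mem.
have f0 i : ((cyc_map c).1 i == 0) = (c.1 i == 0).
  have [/lfun_in_injP f0 _] := f_vertices i; rewrite ffunE.
  apply/eqP/eqP=> [/f0-> // | ->]; last exact: linear0.
  exact: cycle_vertex_mem.
case: s => [||a l]; last 1 first.
- apply/cycles_spanP/cycles_spanP=> -[_ vtx0 lab0]; split=> // i /vtx0/eqP.
    by rewrite f0 => /eqP.
  by rewrite -f0 => /eqP.
- rewrite !memv0; apply/eqP/eqP=> [c0 | ->]; last exact: linear0.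
  by apply: cyc_map_inj; rewrite ?mem0v ?c0 ?linear0.
- by rewrite cT fcT.
Qed.

Lemma cyc_map_cycle_iso : cycle_iso T T' (linfun cyc_map).
Proof.
move=> s; have sT := subvP (cycles_span_sub T s).
have sT' := subvP (cycles_span_sub T' s).
split; last by move=> c _; rewrite comp_lfunE !lfunE.
split; first by move=> c d /sT cT /sT dT; rewrite !lfunE; apply: cyc_map_inj.
apply/vspaceP=> d; apply/memv_imgP/idP=> [[c cS ->] | dS].
  by rewrite lfunE cyc_map_span ?sT.
have := sT' d dS; rewrite -limg_cyc_map => /memv_imgP[c cT d_c].
by exists c => //; rewrite -cyc_map_span //; move: dS; rewrite d_c lfunE.
Qed.

End LinIsoToCycleIso.

Lemma lin_iso_cycle_iso (F : finFieldType) (n : nat) (vT vT' : vectType F)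
    (T : trellis F n vT) (T' : trellis F n vT') :
  trellis_wf T -> trellis_wf T' -> lin_iso T T' -> exists g, cycle_iso T T' g.
Proof.
move=> wfT wfT' [f fP]; exists (linfun (cyc_map f)).
apply: cyc_map_cycle_iso => // [i | i v w a vV wV]; have [fV f_inj fE] := fP i.
  by split.
exact: fE.
Qed.

Lemma lin_iso_same_span_data (F : finFieldType) (n : nat) (vT vT' : vectType F)
    (T : trellis F n vT) (T' : trellis F n vT') :
    trellis_wf T -> trellis_wf T' -> reduced T -> reduced T' ->
  lin_iso T T' <-> same_span_data T T'.
Proof.
move=> wfT wfT' redT redT'; split.
  by case/(lin_iso_cycle_iso wfT wfT')=> g /cycle_iso_same_span_data.
by case/same_span_data_cycle_iso=> g; apply: cycle_iso_lin_iso.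
Qed.

Lemma one_to_one_dim_code_span (F : finFieldType) (n : nat) (vT : vectType F)
    (T : trellis F n vT) (s : trspan n) :
  one_to_one T -> \dim (code_span T s) = \dim (cycles_span T s).
Proof.
move=> L_inj; apply: limg_inj_dim => c d.
move=> /(subvP (cycles_span_sub T s)) cT /(subvP (cycles_span_sub T s)) dT.
by rewrite !lfunE; apply: L_inj.
Qed.

Theorem mainTheorem5 (F : finFieldType) (n : nat) (n_gt0 : (0 < n)%N)
  (vT vT' : vectType F) (T : trellis F n vT) (T' : trellis F n vT') :
  trellis_wf T -> trellis_wf T' -> reduced T -> reduced T' ->
  (lin_iso T T' <->
     (forall s : trspan n,
        \dim (cycles_span T s) = \dim (cycles_span T' s) /\
        code_span T s = code_span T' s))
  /\ (one_to_one T -> one_to_one T' ->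
      (lin_iso T T' <-> forall s : trspan n, code_span T s = code_span T' s)).
Proof.
move=> wfT wfT' redT redT'.
have iso_iff := lin_iso_same_span_data wfT wfT' redT redT'.
split=> // inj inj'; rewrite iso_iff.
split=> [same_spans s | eq_codes s]; first by have [] := same_spans s.
by rewrite -!one_to_one_dim_code_span // eq_codes.
Qed.
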